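(* Let $\{x_1,\dots,x_n\}$ be a linearly independent system of vectors in $H$, let $M:=\operatorname{span}\{x_1,\dots,x_n\}$, and let $x\in H$ with $x\notin M^{\perp}$. Then $$d^2(x,M)\le\frac{\|x\|^2\max_{1\le i\le n}\left[\sum_{j=1}^n|\langle x_i,x_j\rangle|\right]-\sum_{i=1}^n|\langle x,x_i\rangle|^2}{\max_{1\le i\le n}\left[\sum_{j=1}^n|\langle x_i,x_j\rangle|\right]},$$ or, equivalently, $$\Gamma(x_1,\dots,x_n,x)\le\frac{\|x\|^2\max_{1\le i\le n}\left[\sum_{j=1}^n|\langle x_i,x_j\rangle|\right]-\sum_{i=1}^n|\langle x,x_i\rangle|^2}{\max_{1\le i\le n}\left[\sum_{j=1}^n|\langle x_i,x_j\rangle|\right]}\cdot\Gamma(x_1,\dots,x_n).$$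
   Context: $(H;\langle\cdot,\cdot\rangle)$ is an inner product space over the real or complex number field $\mathbb{K}$, with norm $\|x\|=\langle x,x\rangle^{1/2}$. $M^{\perp}$ is the orthogonal complement of $M$ in $H$, and $d(x,M)=\inf_{y\in M}\|x-y\|$ is the distance from $x$ to $M$. For vectors $y_1,\dots,y_m\in H$, $\Gamma(y_1,\dots,y_m)$ denotes the Gram determinant, i.e. the determinant of the $m\times m$ matrix whose $(i,j)$-entry is $\langle y_i,y_j\rangle$. *)

(* Defs.v *)
From mathcomp Require Import all_boot all_order all_algebra.
From mathcomp Require Import sesquilinear complex.
From mathcomp Require Import boolp classical_sets reals.

Set Implicit Arguments.
Unset Strict Implicit.
Unset Printing Implicit Defensive.

Import Order.TTheory GRing.Theory Num.Theory.

Local Open Scope classical_set_scope.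
Local Open Scope ring_scope.

Inductive scalar_kind := RealScalars | ComplexScalars.

Definition scalar_field (R : realType) (k : scalar_kind) : numFieldType :=
  match k with
  | RealScalars => R
  | ComplexScalars => R[i]
  end.

Definition scalar_conj (R : realType) (k : scalar_kind) :
    scalar_field R k -> scalar_field R k :=
  match k with
  | RealScalars => fun z : R => z
  | ComplexScalars => fun z : R[i] => (z^*)%C
  end.

Definition scalar_re (R : realType) (k : scalar_kind) : scalar_field R k -> R :=
  match k with
  | RealScalars => fun z : R => z
  | ComplexScalars => fun z : R[i] => complex.Re z
  end.

Definition scalar_of_real (R : realType) (k : scalar_kind) :
    R -> scalar_field R k :=
  match k with
  | RealScalars => fun r : R => r
  | ComplexScalars => fun r : R => (r%:C)%C
  end.

(* `|z| is an element of the scalar field; scalar_re reads it as a real. *)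
Definition modulus (R : realType) (k : scalar_kind) (z : scalar_field R k) : R :=
  scalar_re `|z|.

(* {dot H for theta} is linear in its first argument and theta-semilinear in
   its second one, with 0 < form u u for u != 0. *)
Notation inner_product R k H := {dot H for @scalar_conj R k}.

Section InnerProductSpace.
Context (R : realType) (k : scalar_kind) (H : lmodType (scalar_field R k)).
Variable (form : inner_product R k H).

Definition ip_norm (x : H) : R := Num.sqrt (scalar_re (form x x)).

Definition orthocomplement (M : set H) : set H :=
  [set x | forall y, M y -> form x y = 0].

Definition distance (x : H) (M : set H) : R :=
  inf [set ip_norm (x - y) | y in M].

Definition Gram (m : nat) (y : m.-tuple H) : scalar_field R k :=
  \det (\matrix_(i < m, j < m) form (tnth y i) (tnth y j)).

(* Row sums are nonnegative, so 0 does not affect the maximum when 0 < n. *)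
Definition max_row_sum (n : nat) (x : n.-tuple H) : R :=
  \big[Num.max/0]_(i < n) \sum_(j < n) modulus (form (tnth x i) (tnth x j)).

End InnerProductSpace.

(* H need not be finite-dimensional, so MathComp's free and span, which are
   about vectType, do not apply. *)
Definition linearly_independent (K : fieldType) (H : lmodType K) (n : nat)
    (x : n.-tuple H) : Prop :=
  forall c : 'I_n -> K,
    \sum_(i < n) c i *: tnth x i = 0 -> forall i, c i = 0.

Definition linear_span (K : fieldType) (H : lmodType K) (n : nat)
    (x : n.-tuple H) : set H :=
  [set y | exists c : 'I_n -> K, y = \sum_(i < n) c i *: tnth x i].

(* Main.v *)
(** Take [y = sum_i (<x, x_i> / mu) x_i] in [M].  By AM-GM the form
    [sum_{i,j} c_i conj(c_j) <x_i, x_j>] is at most [mu * sum_i |c_i|^2], and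
    expanding [|x - y|^2] with this estimate yields exactly the stated bound.
    The Gram inequality follows from
    [Gram(x_1, ..., x_n, x) = |x - p|^2 Gram(x_1, ..., x_n)], where [p] is the
    orthogonal projection of [x] on [M] (so [|x - p| <= |x - y|]). *)
From HB Require Import structures.
Require Import Defs.
From mathcomp Require Import all_boot all_order all_algebra.
From mathcomp Require Import sesquilinear complex.
From mathcomp Require Import boolp classical_sets reals.

Set Implicit Arguments.
Unset Strict Implicit.
Unset Printing Implicit Defensive.

Import Order.TTheory GRing.Theory Num.Theory.

Local Open Scope classical_set_scope.
Local Open Scope ring_scope.

(** * Inner products over a field with an abstract conjugation *)

Section DotForm.
Variables (K : numFieldType) (theta : {rmorphism K -> K}).
(** With this identity the ring morphism [theta] acts as a conjugation, so one argument serves both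
    the identity on the reals and complex conjugation. *)
Hypothesis mul_theta : forall z, z * theta z = `|z| ^+ 2.
Variables (H : lmodType K) (form : {dot H for theta}).

Local Notation "''[' u , v ]" := (form u%R v%R) : ring_scope.
Local Notation "''[' u ]" := '[u, u]%R : ring_scope.

Lemma theta_ge0 z : 0 <= z -> theta z = z.
Proof.
move=> z_ge0; have [->|z_neq0] := eqVneq z 0; first exact: rmorph0.
by apply: (mulfI z_neq0); rewrite mul_theta ger0_norm // expr2.
Qed.

Lemma norm_theta z : `|theta z| = `|z|.
Proof.
have [->|z_neq0] := eqVneq z 0; first by rewrite rmorph0.
have /(congr1 (fun u => `|u|)) := mul_theta z.
by rewrite normrM normrX normr_id expr2 => /mulfI; apply; rewrite normr_eq0.
Qed.

Lemma dot_conj u v : '[u, v] = theta '[v, u].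
Proof. by rewrite hermC expr0 mul1r. Qed.

(* [linearBl] and [linearBr] leave [form] under a coercion that later rewrites
   do not recognise; these restatements do not. *)
Lemma dot_subl u v w : '[u - v, w] = '[u, w] - '[v, w].
Proof. exact: linearBl. Qed.

Lemma dot_subr u v w : '[w, u - v] = '[w, u] - '[w, v].
Proof. exact: linearBr. Qed.

Lemma dot_ge0 u : 0 <= '[u].
Proof.
have [->|/neq0_dnorm_gt0 uu_gt0] := eqVneq u 0; first by rewrite linear0l.
exact: ltW (uu_gt0 _ form).
Qed.

Lemma dot_eq0 u : '[u] = 0 -> u = 0.
Proof.
move=> uu0; apply/eqP; apply: contraT => /neq0_dnorm_gt0 uu_gt0.
by have := uu_gt0 _ form; rewrite uu0 ltxx.
Qed.

(** * Row-sum bounds for linear combinations *)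

Section LinearCombinations.
Variables (n : nat) (f : 'I_n -> H).

Lemma dot_suml (c : 'I_n -> K) v :
  '[\sum_i c i *: f i, v] = \sum_i c i * '[f i, v].
Proof. by rewrite linear_sumlz; apply: eq_bigr => i _; rewrite linearZl_LR. Qed.

Lemma dot_sumr (c : 'I_n -> K) v :
  '[v, \sum_i c i *: f i] = \sum_i theta (c i) * '[v, f i].
Proof. by rewrite linear_sumr; apply: eq_bigr => i _; rewrite linearZr_LR. Qed.

(** The moduli [g i j] are symmetric. So, after AM-GM, swapping the sums turns the half weighted by
    [|c j|^2] into the one weighted by [|c i|^2], where the row sums apply. *)
Lemma dot_comb_le (M : K) (c : 'I_n -> K) :
    (forall i, \sum_j `|'[f i, f j]| <= M) ->
  '[\sum_i c i *: f i] <= M * \sum_i `|c i| ^+ 2.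
Proof.
move=> row_le; set S := \sum_i `|c i| ^+ 2.
set g := fun i j => `|'[f i, f j]|.
have gC i j : g i j = g j i by rewrite /g dot_conj norm_theta.
have half_le : \sum_i \sum_j `|c i| ^+ 2 * g i j <= M * S.
  rewrite mulr_sumr; apply: ler_sum => i _; rewrite -mulr_sumr mulrC.
  by rewrite ler_wpM2r ?exprn_ge0 ?row_le.
rewrite -[leLHS]ger0_norm ?dot_ge0 // dot_suml.
apply: (@le_trans _ _ (\sum_i \sum_j `|c i| * `|c j| * g i j)).
  apply: le_trans (ler_norm_sum _ _ _) _; apply: ler_sum => i _.
  rewrite dot_sumr mulr_sumr; apply: le_trans (ler_norm_sum _ _ _) _.
  by apply: ler_sum => j _; rewrite !normrM norm_theta mulrA.
(* Doubling both sides lets AM-GM be used as [2ab <= a^2 + b^2]. *)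
rewrite -(ler_pM2r (ltr0n K 2)) mulr_suml [leRHS]mulr_natr [leRHS]mulr2n.
apply: (@le_trans _ _
  (\sum_i \sum_j `|c i| ^+ 2 * g i j + \sum_i \sum_j `|c j| ^+ 2 * g i j)).
  rewrite -big_split; apply: ler_sum => i _; rewrite -big_split mulr_suml.
  apply: ler_sum => j _; rewrite /= -mulrDl mulrAC ler_wpM2r ?normr_ge0 //.
  rewrite mulr_natr -subr_ge0.
  have -> : `|c i| ^+ 2 + `|c j| ^+ 2 - `|c i| * `|c j| *+ 2
      = (`|c i| - `|c j|) ^+ 2 by rewrite sqrrB addrAC.
  (* The order on [K] may be partial, so the base of the square must be shown to be real. *)
  by rewrite real_exprn_even_ge0 // realB ?normr_real.
apply: lerD => //; rewrite exchange_big /=.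
apply: le_trans half_le; apply: ler_sum => i _; apply: ler_sum => j _.
by rewrite gC.
Qed.

(** For coefficients [t * '[x, f i]] with [t] real, the upper estimate is ['[x] - 2 t S + t^2 M S],
    where [S] sums the squared moduli; [t = 1 / M] minimizes it. *)
Lemma dot_sub_comb_le (M : K) (x : H) :
    0 < M -> (forall i, \sum_j `|'[f i, f j]| <= M) ->
  '[x - \sum_i ('[x, f i] / M) *: f i] <= '[x] - (\sum_i `|'[x, f i]| ^+ 2) / M.
Proof.
move=> M_gt0 row_le; set y := \sum_i _; set S := \sum_i `|_| ^+ 2.
have S_ge0 : 0 <= S by apply: sumr_ge0 => i _; rewrite exprn_ge0.
have xyE : '[x, y] = S / M.
  rewrite dot_sumr mulr_suml; apply: eq_bigr => i _.
  rewrite rmorphM [theta M^-1]theta_ge0 ?invr_ge0 1?ltW //.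
  by rewrite mulrC mulrA mul_theta.
have yy_le : '[y] <= S / M.
  apply: le_trans (dot_comb_le _ row_le) _.
  rewrite le_eqVlt; apply/orP; left; apply/eqP.
  rewrite mulr_sumr mulr_suml; apply: eq_bigr => i _.
  rewrite normrM exprMn [X in _ * (_ * X ^+ 2)]ger0_norm ?invr_ge0 1?ltW //.
  by rewrite mulrCA expr2 !mulrA mulfK ?gt_eqF // divff ?gt_eqF // mul1r.
(* Since [S / M] is nonnegative, [theta] fixes it: both cross terms equal [S / M], and ['[y]]
   offsets at most one of them. *)
rewrite hnormB /= xyE expr0 mul1r theta_ge0; last first.
  by rewrite divr_ge0 // ltW.
by rewrite opprD addrA lerD2r lerBlDr lerD2l.
Qed.

End LinearCombinations.

(** * Gram determinants and orthogonal projection *)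

(* Indexing the vectors by [nat] lets [n.+1] be rewritten to [n + 1], the
   dimension of a block matrix. *)
Definition gram_mx (n : nat) (f : nat -> H) : 'M[K]_n :=
  \matrix_(i, j) '[f i, f j].

(** Coefficients form a row vector so that rows of a kernel matrix can be plugged in directly. *)
Definition free_family (n : nat) (f : nat -> H) :=
  forall c : 'rV[K]_n, \sum_(i < n) c 0 i *: f i = 0 -> c = 0.

Lemma free_family_prefix n f :
  free_family (n + 1) f -> free_family n f.
Proof.
move=> f_free c c0; have /f_free: \sum_(i < n + 1)
    (row_mx c 0 : 'rV_(n + 1)) 0 i *: f i = 0.
  rewrite big_split_ord /= big_ord1 row_mxEr mxE scale0r addr0 -[RHS]c0.
  by apply: eq_bigr => i _; rewrite row_mxEl.
by rewrite -[0 in RHS]row_mx0 => /eq_row_mx [].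
Qed.

(** If a row [c] kills the Gram matrix from the left, the combination it defines is orthogonal to
    every [f j], hence to itself, so it vanishes and freeness gives [c = 0]. *)
Lemma gram_mx_unit n f : free_family n f -> gram_mx n f \in unitmx.
Proof.
move=> f_free; rewrite -row_free_unit -kermx_eq0; apply/eqP/row_matrixP => i.
rewrite row0; apply: f_free; apply: dot_eq0.
have /rowP cG0 : row i (kermx (gram_mx n f)) *m gram_mx n f = 0.
  by apply/sub_kermxP; exact: row_sub.
rewrite dot_sumr big1 // => j _; rewrite dot_suml.
have := cG0 j; rewrite !mxE => cGj.
suff -> : \sum_l row i (kermx (gram_mx n f)) 0 l * '[f l, f j] = 0 by rewrite mulr0.
by rewrite -[RHS]cGj; apply: eq_bigr => l _; rewrite [gram_mx n f _ _]mxE.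
Qed.

(** The normal equations [c *m G = b] give the coefficients of the projection of [f n]. Subtracting
    that combination of the first [n] rows from the last row clears it up to its corner, which is
    ['[z, f n] = '[z]]. *)
Lemma det_gram_mx_last n f : free_family n f ->
  exists c : 'rV[K]_n, let z := f n - \sum_(i < n) c 0 i *: f i in
    (forall i : 'I_n, '[z, f i] = 0) /\
    \det (gram_mx (n + 1) f) = '[z] * \det (gram_mx n f).
Proof.
move=> f_free; set G := gram_mx n f.
have G_unit : G \in unitmx by exact: gram_mx_unit.
pose b : 'rV_n := \row_j '[f n, f j].
have [c cG] : exists c, c *m G = b by exists (b *m invmx G); rewrite mulmxKV.
exists c; move=> z.
have z_orth (i : 'I_n) : '[z, f i] = 0.
  rewrite /z dot_subl dot_suml; have /rowP/(_ i) := cG; rewrite !mxE => <-.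
  by apply/eqP; rewrite subr_eq0; apply/eqP; apply: eq_bigr => j _; rewrite mxE.
have zzE : '[z] = '[z, f n].
  rewrite [in X in '[_, X]]/z dot_subr dot_sumr [X in _ - X]big1 ?subr0 // => i _.
  by rewrite z_orth mulr0.
split=> //; pose b' : 'cV_n := \col_i '[f i, f n].
pose L : 'M_(n + 1) := block_mx 1%:M 0 (- c) 1%:M.
have GE : gram_mx (n + 1) f = block_mx G b' b (const_mx '[f n]).
  apply/matrixP => i j; rewrite mxE.
  by case: (split_ordP i) => k ->; case: (split_ordP j) => l ->;
    rewrite ?block_mxEul ?block_mxEur ?block_mxEdl ?block_mxEdr !mxE /=
            ?(ord1 k) ?(ord1 l) ?addn0.
have -> : \det (gram_mx (n + 1) f) = \det (L *m gram_mx (n + 1) f).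
  by rewrite det_mulmx det_lblock !det1 !mul1r.
rewrite GE mulmx_block !mul1mx !mul0mx !addr0 !mulNmx cG addNr det_ublock.
rewrite mulrC; congr (_ * _); rewrite det_mx11 zzE /z dot_subl dot_suml.
rewrite !mxE addrC; congr (_ - _).
by apply: eq_bigr => i _; rewrite mxE.
Qed.

(** Starting from the empty determinant 1, each new vector contributes the squared norm of its
    residual as a factor. *)
Lemma det_gram_mx_ge0 n f : free_family n f -> 0 <= \det (gram_mx n f).
Proof.
elim: n => [|n IHn]; first by rewrite det_mx00.
rewrite -addn1 => /free_family_prefix f_free.
have [c [_ ->]] := det_gram_mx_last f_free.
by rewrite mulr_ge0 ?dot_ge0 ?IHn.
Qed.

(** Pythagoras: replacing the projection by another combination adds to the residual [z] a vector
    [w] orthogonal to it. *)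
Lemma det_gram_mx_last_le n f (c : 'I_n -> K) : free_family n f ->
  \det (gram_mx n.+1 f) <= '[f n - \sum_i c i *: f i] * \det (gram_mx n f).
Proof.
move=> f_free; rewrite -addn1; have [e [z_orth ->]] := det_gram_mx_last f_free.
rewrite ler_wpM2r ?det_gram_mx_ge0 //; set z := f n - _ in z_orth *.
have -> : f n - \sum_i c i *: f i = z + \sum_i (e 0 i - c i) *: f i.
  under [in RHS]eq_bigr do rewrite scalerBl.
  by rewrite sumrB addrA subrK.
set w := \sum_i _; have zw0 : '[z, w] = 0.
  by rewrite dot_sumr big1 // => i _; rewrite z_orth mulr0.
by rewrite (hnormDd zw0) lerDl dot_ge0.
Qed.

End DotForm.

(** * Uniform treatment of real and complex scalars *)

Section Scalars.
Variables (R : realType) (k : scalar_kind).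

Lemma scalar_of_real_zmod_morphism : zmod_morphism (@scalar_of_real R k).
Proof. by case: k => //= x y; rewrite rmorphB. Qed.

Lemma scalar_of_real_monoid_morphism : monoid_morphism (@scalar_of_real R k).
Proof. by case: k; split=> //= x y; rewrite rmorphM. Qed.

HB.instance Definition _ := GRing.isZmodMorphism.Build R (scalar_field R k)
  (@scalar_of_real R k) scalar_of_real_zmod_morphism.
HB.instance Definition _ := GRing.isMonoidMorphism.Build R (scalar_field R k)
  (@scalar_of_real R k) scalar_of_real_monoid_morphism.

Lemma scalar_conj_zmod_morphism : zmod_morphism (@scalar_conj R k).
Proof. by case: k => //= x y; rewrite rmorphB. Qed.

Lemma scalar_conj_monoid_morphism : monoid_morphism (@scalar_conj R k).
Proof.
case: k; split=> // [|x y]; first exact: conjc1.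
exact: (rmorphM (@conjc R)).
Qed.

HB.instance Definition _ := GRing.isZmodMorphism.Build
  (scalar_field R k) (scalar_field R k)
  (@scalar_conj R k) scalar_conj_zmod_morphism.
HB.instance Definition _ := GRing.isMonoidMorphism.Build
  (scalar_field R k) (scalar_field R k)
  (@scalar_conj R k) scalar_conj_monoid_morphism.

Lemma mul_scalar_conj (z : scalar_field R k) : z * scalar_conj z = `|z| ^+ 2.
Proof.
case: k z => z /=; last by rewrite sqr_normc.
by rewrite real_normK ?num_real // expr2.
Qed.

Lemma ler_scalar_of_real : {mono @scalar_of_real R k : r s / r <= s}.
Proof. by case: k => r s //=; rewrite lecR. Qed.

Lemma scalar_reK (z : scalar_field R k) :
  0 <= z -> scalar_of_real k (scalar_re z) = z.
Proof. by case: k z => z //= z_ge0; rewrite RRe_real ?ger0_real. Qed.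

Lemma modulusK (z : scalar_field R k) : scalar_of_real k (modulus z) = `|z|.
Proof. by rewrite scalar_reK. Qed.

Lemma modulus_ge0 (z : scalar_field R k) : 0 <= modulus z.
Proof. by rewrite -ler_scalar_of_real modulusK rmorph0. Qed.

Variables (H : lmodType (scalar_field R k)) (form : inner_product R k H).

Lemma ip_normK x : scalar_of_real k (ip_norm form x ^+ 2) = form x x.
Proof.
rewrite sqr_sqrtr ?scalar_reK ?dot_ge0 //.
by rewrite -ler_scalar_of_real rmorph0 scalar_reK ?dot_ge0.
Qed.

Lemma distance_sqr_le x (M : set H) y :
  M y -> distance form x M ^+ 2 <= ip_norm form (x - y) ^+ 2.
Proof.
(* The bound 0 serves twice: it puts the infimum below each member, and it makes the distance
   nonnegative so that squares can be compared. *)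
move=> My; have lb0 : lbound [set ip_norm form (x - y) | y in M] 0.
  by move=> _ [u _ <-]; rewrite sqrtr_ge0.
rewrite ler_sqr ?nnegrE ?sqrtr_ge0 //.
  by apply: ge_inf; [exists 0 | exists y].
by apply: lb_le_inf => //; exists (ip_norm form (x - y)); exists y.
Qed.

Lemma row_sum_le n (xs : n.-tuple H) (i : 'I_n) :
  \sum_(j < n) modulus (form (tnth xs i) (tnth xs j)) <= max_row_sum form xs.
Proof.
exact: (le_bigmax _ (fun i => \sum_j modulus (form (tnth xs i) (tnth xs j)))).
Qed.

(** Otherwise every diagonal entry, being at most its row sum, is zero. Then the span is trivial and
    [x] is orthogonal to it; this covers [n = 0] too. *)
Lemma max_row_sum_gt0 n (xs : n.-tuple H) x :
  ~ orthocomplement form (linear_span xs) x -> 0 < max_row_sum form xs.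
Proof.
move=> x_nperp; rewrite ltNge; apply/negP => mu_le0; apply: x_nperp.
move=> _ [c ->]; rewrite big1 ?linear0r // => i _.
suff -> : tnth xs i = 0 by rewrite scaler0.
apply: (@dot_eq0 _ _ _ form); apply/eqP; rewrite -normr_le0 -modulusK.
rewrite -(rmorph0 (@scalar_of_real R k)) ler_scalar_of_real.
apply: le_trans mu_le0; apply: le_trans (row_sum_le xs i).
by rewrite (bigD1 i) //= lerDl sumr_ge0 // => j _; rewrite modulus_ge0.
Qed.

End Scalars.

Theorem theorem4 (R : realType) (k : scalar_kind)
    (H : lmodType (scalar_field R k)) (form : inner_product R k H)
    (n : nat) (xs : n.-tuple H) (x : H)
    (xs_free : linearly_independent xs)
    (x_nperp : ~ orthocomplement form (linear_span xs) x) :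
  let mu := max_row_sum form xs in
  let bound := (ip_norm form x ^+ 2 * mu
                - \sum_(i < n) modulus (form x (tnth xs i)) ^+ 2) / mu in
  distance form x (linear_span xs) ^+ 2 <= bound
  /\ Gram form [tuple of rcons xs x]
     <= scalar_of_real k bound * Gram form xs.
Proof.
move=> mu bound.
have mu_gt0 : 0 < mu := max_row_sum_gt0 x_nperp.
set M := scalar_of_real k mu.
have M_gt0 : 0 < M.
  by rewrite -(rmorph0 (@scalar_of_real R k)) (leW_mono (@ler_scalar_of_real R k)).
have row_le i : \sum_j `|form (tnth xs i) (tnth xs j)| <= M.
  under eq_bigr do rewrite -modulusK.
  by rewrite -rmorph_sum ler_scalar_of_real row_sum_le.
have boundE : scalar_of_real k bound
    = form x x - (\sum_i `|form x (tnth xs i)| ^+ 2) / M.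
  rewrite /bound mulrBl mulfK ?gt_eqF // rmorphB fmorph_div /=.
  rewrite ip_normK rmorph_sum.
  by congr (_ - _ / _); apply: eq_bigr => i _; rewrite rmorphXn /= modulusK.
(* This single [y] yields both bounds: it competes in the infimum, and its residual bounds the ratio
   of Gram determinants. *)
pose c i := form x (tnth xs i) / M; pose y := \sum_i c i *: tnth xs i.
have y_le : form (x - y) (x - y) <= scalar_of_real k bound.
  by rewrite boundE; apply: dot_sub_comb_le => //; exact: mul_scalar_conj.
split.
  apply: (@le_trans _ _ (ip_norm form (x - y) ^+ 2)).
    by apply: distance_sqr_le; exists c.
  by rewrite -(@ler_scalar_of_real R k) ip_normK.
(* Entry [n] of [f] is [x], and freeness is needed only before it, so [x] may lie in the span. *)
pose f := nth 0 (rcons xs x).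
have fE (i : 'I_n) : f i = tnth xs i.
  by rewrite /f nth_rcons size_tuple ltn_ord (tnth_nth 0).
have fnE : f n = x by rewrite /f nth_rcons size_tuple ltnn eqxx.
have f_free : free_family n f.
  move=> e e0; apply/rowP => i; rewrite mxE; apply: (xs_free (e 0)).
  by rewrite -[RHS]e0; apply: eq_bigr => j _; rewrite fE.
have -> : Gram form [tuple of rcons xs x] = \det (gram_mx form n.+1 f).
  by congr (\det _); apply/matrixP => i j; rewrite !mxE !(tnth_nth 0).
have GE : Gram form xs = \det (gram_mx form n f).
  by congr (\det _); apply/matrixP => i j; rewrite !mxE !fE.
have := det_gram_mx_last_le form c f_free.
rewrite GE fnE => /le_trans; apply; rewrite ler_wpM2r //.
  exact: det_gram_mx_ge0.
by move: y_le; rewrite /y; under eq_bigr do rewrite -fE.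
Qed.
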